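(* Let $(\mathbf A_{jk})_{j,k=1}^n$ be an array of deterministic matrices in $\mathbb H^d$ that satisfy $$\sum_{j,k=1}^n\mathbf A_{jk}=\mathbf 0\quad\text{and}\quad\|\mathbf A_{jk}\|\le R\quad\text{for each pair }(j,k)\text{ of indices}.$$ Define the random matrix $\mathbf X=\sum_{j=1}^n\mathbf A_{j\pi(j)}$, where $\pi$ is a uniformly random permutation of $\{1,\dots,n\}$. Then, for all $t\ge0$, $$\mathbb P\{\lambda_{\max}(\mathbf X)\ge t\}\le d\cdot\exp\Big\{\frac{-t^2}{12\sigma^2+4\sqrt2\,Rt}\Big\}\qquad\text{for }\ \sigma^2=\frac1n\Big\|\sum_{j,k=1}^n\mathbf A_{jk}^2\Big\|.$$ Furthermore, $$\mathbb E\,\lambda_{\max}(\mathbf X)\le\sigma\sqrt{12\log d}+2\sqrt2\,R\log d.$$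
   Context: $\mathbb H^d$ is the space of $d\times d$ complex Hermitian matrices; $\lambda_{\max}$ is the largest eigenvalue; $\|\cdot\|$ is the spectral norm. *)

(* Defs.v *)
From HB Require Import structures.
From mathcomp Require Import all_boot all_order all_algebra all_fingroup.
From mathcomp Require Import all_classical all_reals all_analysis.
From mathcomp.real_closed Require Import complex.

Set Implicit Arguments.
Unset Strict Implicit.
Unset Printing Implicit Defensive.

Import Order.TTheory GRing.Theory Num.Theory.

Local Open Scope ring_scope.
Local Open Scope classical_set_scope.
Local Open Scope complex_scope.
Local Open Scope sesquilinear_scope.

(* A Hermitian matrix has only real eigenvalues, so for A Hermitian and 0 < d
   this supremum is attained and is the largest eigenvalue: see [lambda_maxP].
   For d = 0 it is the junk value 0. *)
Definition lambda_max (K : realType) (d : nat) (A : 'M[K[i]]_d) : K :=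
  sup [set x : K | eigenvalue A x%:C].

(* The largest singular value of B. *)
Definition spectral_norm (K : realType) (d : nat) (B : 'M[K[i]]_d) : K :=
  Num.sqrt (lambda_max (B ^t* *m B)).

(* The permutations carry no sigma-algebra here: as 'S_n is finite, it is
   enough that each event {pi = s} is measurable. *)
Definition uniform_perm (disp : measure_display) (T : measurableType disp)
    (K : realType) (P : probability T K) (n : nat) (pi : T -> 'S_n) : Prop :=
  forall s : 'S_n, measurable (pi @^-1` [set s]) /\
    P (pi @^-1` [set s]) = ((n`!%:R : K)^-1)%:E.

Definition perm_sum (K : realType) (n d : nat)
    (A : 'I_n -> 'I_n -> 'M[K[i]]_d) (s : 'S_n) : 'M[K[i]]_d :=
  \sum_(j < n) A j (s j).

Lemma lambda_maxP (K : realType) (d : nat) (A : 'M[K[i]]_d) :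
  (0 < d)%N -> A \is hermsymmx ->
  eigenvalue A (lambda_max A)%:C /\
  (forall z : K[i], eigenvalue A z -> z <= (lambda_max A)%:C).
Proof.
move=> d0 hA.
have /mxOverP sp_real := hermitian_spectral_diag_real hA.
have /orthomx_spectralP := hermitian_normalmx hA.
set Q := spectralmx A; set D := spectral_diag A => defA.
have Qu : Q \in unitmx by rewrite unitarymx_unit // spectral_unitarymx.
have eigD i : eigenvalue A (D 0 i).
  apply/eigenvalueP; exists (row i Q).
    rewrite defA !mulmxA -row_mul mulmxV // row1.
    by rewrite -rowE row_diag_mx -scalemxAl -rowE.
  apply/eqP => /(congr1 (mulmx^~ (invmx Q))); rewrite mul0mx -row_mul mulmxV //.
  by rewrite row1 => /rowP/(_ i)/eqP; rewrite !mxE !eqxx oner_eq0.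
have Deig z : eigenvalue A z -> exists i, z = D 0 i.
  move=> /eigenvalueP[v vA v0].
  have: v *m invmx Q != 0.
    apply: contraNneq v0 => /(congr1 (mulmx^~ Q)).
    by rewrite mulmxKV // mul0mx => ->.
  move=> /rV0Pn[i wi]; exists i; apply/(mulIf wi)/esym.
  have := congr1 (mulmx^~ (invmx Q)) vA.
  rewrite {1}defA !mulmxA mulmxK // -scalemxAl mul_mx_diag.
  by move=> /rowP/(_ i); rewrite !mxE mulrC.
have DRe i : D 0 i = (complex.Re (D 0 i))%:C by apply/esym/RRe_real/sp_real.
have [m maxm] : exists m, forall i, complex.Re (D 0 i) <= complex.Re (D 0 m).
  exists [arg max_(m > Ordinal d0) complex.Re (D 0 m)]%O.
  by case: arg_maxP => // m _ h i; exact: h.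
have -> : lambda_max A = complex.Re (D 0 m).
  apply: le_anti; apply/andP; split.
    apply: ge_sup; first by exists (complex.Re (D 0 m)); rewrite /= -DRe.
    by move=> x /= /Deig[i Ei]; have := maxm i; rewrite -Ei.
  apply: ub_le_sup; last by rewrite /= -DRe.
  exists (complex.Re (D 0 m)) => x /= /Deig[i Ei].
  by have := maxm i; rewrite -Ei.
rewrite -DRe; split=> // z /Deig[i ->].
by rewrite [leLHS]DRe [leRHS]DRe lecR.
Qed.

(* Main.v *)
(** The proof is the method of exchangeable pairs.  Composing a permutation [s]
    with a transposition [(j k)] changes [X s = \sum_j A j (s j)] by a
    combination of four entries of the array, and averaging this change over all
    [(j, k)] gives back a multiple of [X s].  Symmetrising under the exchange and
    using the mean value inequality for the trace bounds the derivative of the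
    trace moment generating function [m t] of [X] by
    [2 t E tr (Y + S) e^(t X)], where [Y s = \sum_j A j (s j) ^ 2] and [S] is the
    mean of [Y].  Now [W = Y - S] is itself the centered sum of the array of the
    squares, so the same bound controls its moment generating function, and
    Young's inequality for the entropy turns this into a bound of
    [E tr W e^(t X)] by [m] and [m'].  The resulting differential inequality
    [(1 - c t) m' <= v t m], with [v = 6 sigma^2] and [c = 2 sqrt 2 R], is
    integrated, and the Laplace transform method yields both estimates. *)
Require Import Defs.
From mathcomp Require Import all_boot all_order all_algebra all_fingroup.
From mathcomp Require Import all_classical all_reals all_analysis.
From mathcomp.real_closed Require Import complex.
From mathcomp Require Import ring lra.

Set Implicit Arguments.
Unset Strict Implicit.

Import Order.TTheory GRing.Theory Num.Theory.

Local Open Scope ring_scope.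
Local Open Scope classical_set_scope.
Local Open Scope complex_scope.
Local Open Scope sesquilinear_scope.

(** * Quadratic forms and eigenbasis coordinates of Hermitian matrices *)

Definition modsq {K : realType} (z : K[i]) : K :=
  complex.Re z ^+ 2 + complex.Im z ^+ 2.

Definition normsq {K : realType} {d : nat} (u : 'rV[K[i]]_d) : K :=
  \sum_j modsq (u 0 j).

(** For Hermitian [M] the entry is already real; taking the real part gives a [K]-valued form that
    is additive for every [M]. *)
Definition qform {K : realType} {d : nat} (M : 'M[K[i]]_d) (u : 'rV[K[i]]_d) : K :=
  complex.Re ((u *m M *m u ^t*) 0 0).

Definition eigval {K : realType} {d : nat} (X : 'M[K[i]]_d) (i : 'I_d) : K :=
  complex.Re (spectral_diag X 0 i).

(** The rows of the unitary diagonaliser are left eigenvectors; hence vectors are rows and matrices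
    act on the right. *)
Definition eigvec {K : realType} {d : nat} (X : 'M[K[i]]_d) (i : 'I_d) :
  'rV[K[i]]_d := row i (spectralmx X).

Lemma modsq_ge0 (K : realType) (z : K[i]) : 0 <= modsq z.
Proof. by rewrite addr_ge0 ?sqr_ge0. Qed.

Lemma normsq_ge0 (K : realType) d (u : 'rV[K[i]]_d) : 0 <= normsq u.
Proof. by apply: sumr_ge0 => j _; exact: modsq_ge0. Qed.

Lemma modsqE (K : realType) (z : K[i]) : (modsq z)%:C = z * z^*%C.
Proof.
case: z => a b; rewrite /modsq /=; apply/eqP; rewrite eq_complex /=.
by apply/andP; split; apply/eqP; ring.
Qed.

Lemma modsqC (K : realType) (z : K[i]) : modsq z^*%C = modsq z.
Proof. by case: z => a b; rewrite /modsq /= sqrrN. Qed.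

Lemma modsqZ (K : realType) (x : K) (z : K[i]) : modsq (x%:C * z) = x ^+ 2 * modsq z.
Proof. by case: z => a b; rewrite /modsq /=; ring. Qed.

Lemma normsqE (K : realType) d (u : 'rV[K[i]]_d) : (normsq u)%:C = (u *m u ^t*) 0 0.
Proof.
rewrite /normsq raddf_sum /= mxE; apply: eq_bigr => j _.
by rewrite !mxE -modsqE.
Qed.

Lemma normsq0_eq (K : realType) d (u : 'rV[K[i]]_d) : normsq u = 0 -> u = 0.
Proof.
move=> /eqP; rewrite psumr_eq0 => [/allP u0|j _]; last exact: modsq_ge0.
apply/rowP => j; have /eqP := u0 j (mem_index_enum j); rewrite mxE.
move=> /(congr1 (real_complex K)); rewrite modsqE -normCK => /eqP.
by rewrite sqrf_eq0 normr_eq0 => /eqP.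
Qed.

Lemma adjmx_mul (C : numClosedFieldType) m n p (A : 'M[C]_(m, n)) (B : 'M[C]_(n, p)) :
  (A *m B) ^t* = B ^t* *m A ^t*.
Proof. by rewrite trmx_mul map_mxM. Qed.

Lemma hermsymmx_adj (C : numClosedFieldType) d (A : 'M[C]_d) :
  A \is hermsymmx -> A ^t* = A.
Proof. by move=> /is_hermitianmxP; rewrite expr0 scale1r => <-. Qed.

Lemma adj_hermsymmx (C : numClosedFieldType) d (A : 'M[C]_d) :
  A ^t* = A -> A \is hermsymmx.
Proof. by move=> e; apply/is_hermitianmxP; rewrite expr0 scale1r e. Qed.

Lemma spectral_eigvec (K : realType) d (X : 'M[K[i]]_d) i : X \is hermsymmx ->
  eigvec X i *m X = (eigval X i)%:C *: eigvec X i.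
Proof.
move=> hX; have /mxOverP /(_ 0 i) /RRe_real e := hermitian_spectral_diag_real hX.
rewrite /eigval e /eigvec.
have /orthomx_spectralP defX := hermitian_normalmx hX.
rewrite {2}defX !mulmxA -row_mul mulmxV ?spectral_unit // row1.
by rewrite -rowE row_diag_mx -scalemxAl -rowE.
Qed.

Lemma mul_adj_spectralmx (C : numClosedFieldType) d (X : 'M[C]_d) :
  (spectralmx X)^t* *m spectralmx X = 1%:M.
Proof.
by rewrite -invmx_unitary ?spectral_unitarymx // mulVmx // spectral_unit.
Qed.

Lemma parseval (K : realType) d (u : 'rV[K[i]]_d) (Z : 'M[K[i]]_d) :
  normsq u = \sum_j modsq ((u *m (eigvec Z j) ^t*) 0 0).
Proof.
transitivity (normsq (u *m (spectralmx Z)^t*)).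
  apply: complexI; rewrite !normsqE adjmx_mul trmxCK mulmxA -(mulmxA u).
  by rewrite mul_adj_spectralmx mulmx1.
apply: eq_bigr => j _; congr modsq; rewrite !mxE; apply: eq_bigr => k _.
by rewrite !mxE.
Qed.

Lemma normsq_eigvec (K : realType) d (X : 'M[K[i]]_d) i : normsq (eigvec X i) = 1.
Proof.
have /row_unitarymxP /(_ i i) := spectral_unitarymx X.
by rewrite dotmxE -normsqE eqxx => /complexI.
Qed.

(* The doubly stochastic matrix through which a trace such as [tr (f X * g Z)]
   reduces to the scalar sum [\sum_(i, j) overlap X Z i j * f x_i * g z_j]. *)
Definition overlap {K : realType} {d : nat} (X Z : 'M[K[i]]_d) i j : K :=
  modsq ((eigvec X i *m (eigvec Z j) ^t*) 0 0).

Lemma overlap_sym (K : realType) d (X Z : 'M[K[i]]_d) i j :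
  overlap X Z i j = overlap Z X j i.
Proof.
rewrite /overlap -[RHS]modsqC; congr modsq.
rewrite -[in LHS](trmxCK (eigvec X i)) -adjmx_mul.
by rewrite !mxE.
Qed.

Lemma overlap_ge0 (K : realType) d (X Z : 'M[K[i]]_d) i j : 0 <= overlap X Z i j.
Proof. exact: modsq_ge0. Qed.

Lemma sum_overlap (K : realType) d (X Z : 'M[K[i]]_d) i : \sum_j overlap X Z i j = 1.
Proof. by rewrite -parseval normsq_eigvec. Qed.

Lemma herm_eigvecC (K : realType) d (Z : 'M[K[i]]_d) j : Z \is hermsymmx ->
  Z *m (eigvec Z j)^t* = (eigval Z j)%:C *: (eigvec Z j)^t*.
Proof.
move=> hZ; rewrite -{1}(hermsymmx_adj hZ) -adjmx_mul spectral_eigvec //.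
by rewrite linearZ /= map_mxZ; congr (_ *: _); exact: conjc_real.
Qed.

Lemma qform_spectral (K : realType) d (Z : 'M[K[i]]_d) u : Z \is hermsymmx ->
  qform Z u = \sum_j eigval Z j * modsq ((u *m (eigvec Z j) ^t*) 0 0).
Proof.
move=> hZ; rewrite /qform -[u in u *m Z]mulmx1 -(mul_adj_spectralmx Z).
rewrite mulmxA -(mulmxA _ _ Z) -mulmxA [X in complex.Re X]mxE raddf_sum /=.
apply: eq_bigr => j _.
have -> : (u *m (spectralmx Z)^t*) 0 j = (u *m (eigvec Z j)^t*) 0 0.
  by rewrite !mxE; apply: eq_bigr => k _; rewrite !mxE.
have -> : (spectralmx Z *m Z *m u^t*) j 0 =
    (eigval Z j)%:C * ((u *m (eigvec Z j)^t*) 0 0)^*.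
  transitivity ((row j (spectralmx Z) *m Z *m u^t*) 0 0).
    by rewrite -!row_mul [RHS]mxE.
  rewrite spectral_eigvec // -scalemxAl mxE; congr (_ * _).
  by rewrite -[eigvec Z j in LHS]trmxCK -adjmx_mul !mxE.
by rewrite mulrCA -modsqE -rmorphM /=.
Qed.

Lemma qformD (K : realType) d (A B : 'M[K[i]]_d) u :
  qform (A + B) u = qform A u + qform B u.
Proof. by rewrite /qform mulmxDr mulmxDl mxE raddfD. Qed.

Lemma qformN (K : realType) d (A : 'M[K[i]]_d) u : qform (- A) u = - qform A u.
Proof. by rewrite /qform mulmxN mulNmx mxE raddfN. Qed.

Lemma qform0 (K : realType) d (u : 'rV[K[i]]_d) : qform 0 u = 0.
Proof. by rewrite /qform mulmx0 mul0mx mxE. Qed.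

Lemma qform_sum (K : realType) d (I : finType) (F : I -> 'M[K[i]]_d) u :
  qform (\sum_k F k) u = \sum_k qform (F k) u.
Proof.
by apply: (big_morph (fun M => qform M u)) => [A B|]; rewrite ?qformD ?qform0.
Qed.

Lemma qformZ (K : realType) d (x : K) (A : 'M[K[i]]_d) u :
  qform (x%:C *: A) u = x * qform A u.
Proof.
rewrite /qform -scalemxAr -scalemxAl mxE /=.
by case: (_ 0 0) => a b /=; rewrite mul0r subr0.
Qed.

Lemma qform_sqr (K : realType) d (A : 'M[K[i]]_d) u : A \is hermsymmx ->
  qform (A *m A) u = normsq (u *m A).
Proof.
move=> hA; rewrite /qform.
have -> : u *m (A *m A) *m u^t* = (u *m A) *m (u *m A)^t*.
  by rewrite adjmx_mul hermsymmx_adj // !mulmxA.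
by rewrite -normsqE.
Qed.

Lemma qform_eigvec (K : realType) d (X : 'M[K[i]]_d) i : X \is hermsymmx ->
  qform X (eigvec X i) = eigval X i.
Proof.
move=> hX; rewrite /qform spectral_eigvec // -scalemxAl mxE -normsqE normsq_eigvec.
by rewrite mulr1.
Qed.

Lemma qform_overlap (K : realType) d (X Z : 'M[K[i]]_d) i : Z \is hermsymmx ->
  qform Z (eigvec X i) = \sum_j overlap X Z i j * eigval Z j.
Proof.
by move=> hZ; rewrite qform_spectral //; apply: eq_bigr => j _; rewrite mulrC.
Qed.

Lemma qform_sub_eigvec (K : realType) d (X Z : 'M[K[i]]_d) i :
  X \is hermsymmx -> Z \is hermsymmx ->
  qform (X - Z) (eigvec X i) = \sum_j overlap X Z i j * (eigval X i - eigval Z j).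
Proof.
move=> hX hZ; rewrite qformD qformN qform_eigvec // qform_overlap //.
under [RHS]eq_bigr do rewrite mulrBr.
by rewrite sumrB -mulr_suml sum_overlap mul1r.
Qed.

(** Parseval in the eigenbasis of [Z]: the coordinate of [u_i (X - Z)] along [v_j] is [(x_i - z_j)]
    times that of [u_i]. *)
Lemma normsq_sub_eigvec (K : realType) d (X Z : 'M[K[i]]_d) i :
  X \is hermsymmx -> Z \is hermsymmx ->
  normsq (eigvec X i *m (X - Z)) =
  \sum_j overlap X Z i j * (eigval X i - eigval Z j) ^+ 2.
Proof.
move=> hX hZ; rewrite (parseval _ Z); apply: eq_bigr => j _.
rewrite mulmxBr mulmxBl -(mulmxA _ Z) herm_eigvecC // spectral_eigvec //.
rewrite -scalemxAl -scalemxAr -scalerBl -raddfB /= mxE.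
by rewrite modsqZ mulrC.
Qed.

(** * Largest eigenvalue, spectral norm and norm inequalities *)

Lemma lambda_max_eigval (K : realType) d (X : 'M[K[i]]_d) : (0 < d)%N ->
  X \is hermsymmx -> exists i, lambda_max X = eigval X i.
Proof.
move=> d0 hX; have [/eigenvalueP[v vX v0] _] := lambda_maxP d0 hX.
(* By Parseval the nonzero [v] has a nonzero coordinate along some [eigvec X j]; evaluating
   [v X (eigvec X j)^*] from both sides then identifies the two eigenvalues. *)
have [j vj] : exists j, (v *m (eigvec X j)^t*) 0 0 != 0.
  apply: contrapT => /forallNP h; case/eqP: v0; apply: normsq0_eq.
  rewrite (parseval _ X) big1 // => j _; have /negP := h j.
  by rewrite negbK => /eqP ->; rewrite /modsq /= !expr0n addr0.
exists j; apply: complexI.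
have := congr1 (fun M => (M *m (eigvec X j)^t*) 0 0) vX.
rewrite -mulmxA herm_eigvecC // -scalemxAr -scalemxAl mxE [in RHS]mxE.
by move=> /(mulIf vj) ->.
Qed.

Lemma eigval_le_lambda_max (K : realType) d (X : 'M[K[i]]_d) i : (0 < d)%N ->
  X \is hermsymmx -> eigval X i <= lambda_max X.
Proof.
move=> d0 hX; rewrite -lecR; apply: (lambda_maxP d0 hX).2.
apply/eigenvalueP; exists (eigvec X i); first exact: spectral_eigvec.
apply/eqP => e; have := normsq_eigvec X i; rewrite e /normsq big1 => [/esym/eqP|j _].
  by rewrite oner_eq0.
by rewrite mxE /modsq /= !expr0n addr0.
Qed.

Lemma qform_le_lambda_max (K : realType) d (X : 'M[K[i]]_d) u : (0 < d)%N ->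
  X \is hermsymmx -> qform X u <= lambda_max X * normsq u.
Proof.
move=> d0 hX; rewrite qform_spectral // (parseval u X) mulr_sumr.
apply: ler_sum => j _; apply: ler_wpM2r; first exact: modsq_ge0.
exact: eigval_le_lambda_max.
Qed.

Lemma herm_sqr (C : numClosedFieldType) d (A : 'M[C]_d) : A \is hermsymmx ->
  A *m A \is hermsymmx.
Proof. by move=> hA; apply: adj_hermsymmx; rewrite adjmx_mul !hermsymmx_adj. Qed.

Lemma normsq_mul_le (K : realType) d (A : 'M[K[i]]_d) u : (0 < d)%N ->
  A \is hermsymmx -> normsq (u *m A) <= spectral_norm A ^+ 2 * normsq u.
Proof.
move=> d0 hA; rewrite -qform_sqr //.
apply: le_trans (qform_le_lambda_max u d0 (herm_sqr hA)) _.
apply: ler_wpM2r; first exact: normsq_ge0.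
rewrite /spectral_norm hermsymmx_adj //; set l := lambda_max _.
have [l0|l0] := leP 0 l; first by rewrite sqr_sqrtr.
exact: le_trans (ltW l0) (sqr_ge0 _).
Qed.

Lemma spectral_norm_ge0 (K : realType) d (A : 'M[K[i]]_d) : 0 <= spectral_norm A.
Proof. exact: sqrtr_ge0. Qed.

Lemma eigval_le_spectral_norm (K : realType) d (A : 'M[K[i]]_d) i : (0 < d)%N ->
  A \is hermsymmx -> eigval A i <= spectral_norm A.
Proof.
move=> d0 hA; have := normsq_mul_le (eigvec A i) d0 hA.
rewrite normsq_eigvec mulr1 spectral_eigvec //.
have -> : normsq ((eigval A i)%:C *: eigvec A i) = eigval A i ^+ 2.
  rewrite -[RHS]mulr1 -(normsq_eigvec A i) mulr_sumr; apply: eq_bigr => j _.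
  by rewrite mxE modsqZ.
move=> h; apply: le_trans (ler_norm _) _.
by rewrite -(ler_sqr (normr_nneg _) (spectral_norm_ge0 _)) real_normK ?num_real.
Qed.

Lemma qform_le_spectral_norm (K : realType) d (A : 'M[K[i]]_d) u : (0 < d)%N ->
  A \is hermsymmx -> qform A u <= spectral_norm A * normsq u.
Proof.
move=> d0 hA; rewrite qform_spectral // (parseval u A) mulr_sumr.
apply: ler_sum => j _; apply: ler_wpM2r; first exact: modsq_ge0.
exact: eigval_le_spectral_norm.
Qed.

(** Cauchy-Schwarz against the signs [(1, 1, -1, -1)]; by Lagrange's identity the defect is a sum of
    six squares. *)
Lemma modsq_alt4 (K : realType) (a b c e : K[i]) :
  modsq (a + b - c - e) <= 4 * (modsq a + modsq b + modsq c + modsq e).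
Proof.
case: a b c e => [a a'] [b b'] [c c'] [e e']; rewrite /modsq /=.
have h (x y z w : K) :
    (x + y - z - w) ^+ 2 <= 4 * (x ^+ 2 + y ^+ 2 + z ^+ 2 + w ^+ 2).
  rewrite -subr_ge0; set r := _ - _.
  have -> : r = (x - y) ^+ 2 + (x + z) ^+ 2 + (x + w) ^+ 2 +
      (y + z) ^+ 2 + (y + w) ^+ 2 + (z - w) ^+ 2 by rewrite /r; ring.
  by rewrite !addr_ge0 ?sqr_ge0.
by have := h a b c e; have := h a' b' c' e'; lra.
Qed.

Lemma normsq_alt4 (K : realType) d (a b c e : 'rV[K[i]]_d) :
  normsq (a + b - c - e) <= 4 * (normsq a + normsq b + normsq c + normsq e).
Proof.
rewrite /normsq -!big_split /= mulr_sumr; apply: ler_sum => j _.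
by rewrite !mxE; exact: modsq_alt4.
Qed.

Lemma le_of_eq {disp : Order.disp_t} {T : porderType disp} (x y : T) :
  x = y -> (x <= y)%O.
Proof. by move=> ->. Qed.

(** * Sums along a permutation and their change under a transposition *)

Section perm_sums.
Context {V : zmodType} {n : nat}.
Implicit Types (F : 'I_n -> 'I_n -> V) (s : 'S_n).

Lemma sum_diag_l F s : \sum_j \sum_(k < n) F j (s j) = (\sum_j F j (s j)) *+ n.
Proof. by under eq_bigr do rewrite sumr_const card_ord; rewrite sumrMnl. Qed.

Lemma sum_diag_r F s : \sum_(j < n) \sum_k F k (s k) = (\sum_j F j (s j)) *+ n.
Proof. by rewrite sumr_const card_ord. Qed.

Lemma sum_cross_l F s : \sum_j \sum_k F j (s k) = \sum_j \sum_k F j k.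
Proof. by apply: eq_bigr => j _; rewrite [RHS](reindex_inj (@perm_inj _ s)). Qed.

Lemma sum_cross_r F s : \sum_j \sum_k F k (s j) = \sum_j \sum_k F j k.
Proof. by rewrite exchange_big sum_cross_l. Qed.

(** Only the terms at [l = j] and [l = k] change, and they trade their columns [s j] and [s k]; for
    [j = k] both sides vanish. *)
Lemma sum_tperm F s j k :
  \sum_l F l (s l) - \sum_l F l ((tperm j k * s)%g l) =
  F j (s j) + F k (s k) - F j (s k) - F k (s j).
Proof.
rewrite -sumrB; have [->|jk] := eqVneq j k.
  rewrite big1 => [|l _]; first by rewrite addrK subrr.
  by rewrite permM tperm1 perm1 subrr.
have kj : k != j by rewrite eq_sym.
rewrite (bigD1 j) //= (bigD1 k) //= big1 => [|l /andP[lj lk]]; last first.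
  by rewrite permM tpermD ?subrr // eq_sym.
by rewrite !permM tpermL tpermR addr0 addrACA addrA.
Qed.

End perm_sums.

Lemma sum_pairs (K : realType) n (F : 'I_n -> 'I_n -> K) (s : 'S_n) : (0 < n)%N ->
  \sum_j \sum_k (F j (s j) + F k (s k) + F j (s k) + F k (s j)) =
  (2 * n)%:R * (\sum_j F j (s j) + n%:R^-1 * \sum_j \sum_k F j k).
Proof.
move=> n0; have n1 : (n%:R : K) != 0 by rewrite pnatr_eq0 -lt0n.
under eq_bigr do rewrite !big_split /=.
rewrite !big_split /= sum_diag_l sum_diag_r sum_cross_l sum_cross_r.
by rewrite -mulr_natl natrM; field.
Qed.

(** * Centered permutation sums and the exchangeable pair *)

Definition mean {K : realType} {n d : nat} (A : 'I_n -> 'I_n -> 'M[K[i]]_d) :=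
  ((n%:R : K)^-1)%:C *: \sum_j \sum_k A j k.

(** [mean A] is the expectation of [perm_sum A], each entry being picked with probability [1 / n].
    Centering lets the same bounds serve the array of squares, whose total need not vanish. *)
Definition centered_sum {K : realType} {n d : nat} (A : 'I_n -> 'I_n -> 'M[K[i]]_d)
  (s : 'S_n) := perm_sum A s - mean A.

Lemma hermD (C : numClosedFieldType) d (A B : 'M[C]_d) :
  A \is hermsymmx -> B \is hermsymmx -> A + B \is hermsymmx.
Proof.
by move=> hA hB; apply: adj_hermsymmx; rewrite linearD map_mxD !hermsymmx_adj.
Qed.

Lemma hermN (C : numClosedFieldType) d (A : 'M[C]_d) :
  A \is hermsymmx -> - A \is hermsymmx.
Proof.
by move=> hA; apply: adj_hermsymmx; rewrite linearN map_mxN !hermsymmx_adj.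
Qed.

Lemma hermZ (K : realType) d (x : K) (A : 'M[K[i]]_d) :
  A \is hermsymmx -> x%:C *: A \is hermsymmx.
Proof.
move=> hA; apply: adj_hermsymmx; rewrite linearZ map_mxZ /=.
rewrite -[in RHS](hermsymmx_adj hA).
by congr (_ *: _); exact: conjc_real.
Qed.

Lemma herm_sum (C : numClosedFieldType) d (I : finType) (F : I -> 'M[C]_d) :
  (forall k, F k \is hermsymmx) -> \sum_k F k \is hermsymmx.
Proof.
move=> hF; elim/big_ind : _ => //; last exact: hermD.
by apply: adj_hermsymmx; rewrite linear0 map_mx0.
Qed.

Lemma herm_mean (K : realType) n d (A : 'I_n -> 'I_n -> 'M[K[i]]_d) :
  (forall j k, A j k \is hermsymmx) -> mean A \is hermsymmx.
Proof. by move=> hA; apply: hermZ; apply: herm_sum => j; exact: herm_sum. Qed.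

Lemma herm_centered_sum (K : realType) n d (A : 'I_n -> 'I_n -> 'M[K[i]]_d) s :
  (forall j k, A j k \is hermsymmx) -> centered_sum A s \is hermsymmx.
Proof. by move=> hA; apply: hermD; [exact: herm_sum|apply/hermN/herm_mean]. Qed.

Lemma centered_sum_tperm (K : realType) n d (A : 'I_n -> 'I_n -> 'M[K[i]]_d) s j k :
  centered_sum A s - centered_sum A (tperm j k * s)%g =
  A j (s j) + A k (s k) - A j (s k) - A k (s j).
Proof. by rewrite -sum_tperm /centered_sum /perm_sum opprB addrA subrK. Qed.

(** The linear regression property of the exchangeable pair: the diagonal terms contribute [2 n]
    copies of the sum, the cross terms two copies of the whole array, that is [2 n] times the
    mean. *)
Lemma sum_centered_sum_tperm (K : realType) n d (A : 'I_n -> 'I_n -> 'M[K[i]]_d) s :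
  (0 < n)%N ->
  \sum_j \sum_k (centered_sum A s - centered_sum A (tperm j k * s)%g) =
  ((2 * n)%:R : K)%:C *: centered_sum A s.
Proof.
move=> n0; have n0' : (n%:R : K) != 0 by rewrite pnatr_eq0 -lt0n.
under eq_bigr do under eq_bigr do rewrite centered_sum_tperm.
under eq_bigr do rewrite !big_split /= !sumrN.
rewrite !big_split /= !sumrN sum_diag_l sum_diag_r sum_cross_l sum_cross_r.
rewrite /centered_sum /mean scalerBr scalerA -rmorphM natrM mulfK //=.
rewrite -mulrnDr -addrA -opprD; congr (_ - _).
  by rewrite -natrM rmorph_nat scaler_nat mul2n addnn.
by rewrite rmorph_nat scaler_nat mulr2n.
Qed.

(** Expanded in both eigenbases, each trace becomes a double sum with the nonnegative weights
    [overlap X Z i j], so the scalar hypothesis on [f] applies term by term to [x_i] and [z_j]. *)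
Lemma pair_trace_le (K : realType) d (X Z : 'M[K[i]]_d) (f : K -> K) (L : K) :
  X \is hermsymmx -> Z \is hermsymmx ->
  (forall a b, (a - b) * (f a - f b) <= L * ((a - b) ^+ 2 * (f a + f b))) ->
  \sum_i f (eigval X i) * qform (X - Z) (eigvec X i) +
  \sum_i f (eigval Z i) * qform (Z - X) (eigvec Z i) <=
  L * (\sum_i f (eigval X i) * normsq (eigvec X i *m (X - Z)) +
       \sum_i f (eigval Z i) * normsq (eigvec Z i *m (Z - X))).
Proof.
move=> hX hZ hf.
under eq_bigr do rewrite qform_sub_eigvec // mulr_sumr.
under [X in _ + X <= _]eq_bigr do rewrite qform_sub_eigvec // mulr_sumr.
under [X in _ <= _ * (X + _)]eq_bigr do rewrite normsq_sub_eigvec // mulr_sumr.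
under [X in _ <= _ * (_ + X)]eq_bigr do rewrite normsq_sub_eigvec // mulr_sumr.
rewrite [X in _ + X <= _]exchange_big [X in _ <= _ * (_ + X)]exchange_big /=.
rewrite -!big_split /= mulr_sumr; apply: ler_sum => i _.
rewrite -!big_split /= mulr_sumr; apply: ler_sum => j _.
rewrite (overlap_sym Z X j i); have := hf (eigval X i) (eigval Z j).
move=> /(ler_wpM2l (overlap_ge0 X Z i j)); set a := eigval X i.
set b := eigval Z j; set w := overlap _ _ _ _.
rewrite -subr_ge0 => h; rewrite -subr_ge0.
by apply: le_trans h _; apply: le_of_eq; ring.
Qed.

(* Stated for a general [f]: besides [expR (t * _)], it is used for a constant
   [f] with [L = 0], where it says that the eigenvalues sum up to [0]. *)
Lemma exchange_trace_le (K : realType) n d (A : 'I_n -> 'I_n -> 'M[K[i]]_d)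
    (f : K -> K) (L : K) :
  (0 < n)%N -> (forall j k, A j k \is hermsymmx) ->
  (forall a, 0 <= L * f a) ->
  (forall a b, (a - b) * (f a - f b) <= L * ((a - b) ^+ 2 * (f a + f b))) ->
  \sum_s \sum_i f (eigval (centered_sum A s) i) * eigval (centered_sum A s) i <=
  4 * L * \sum_s \sum_i f (eigval (centered_sum A s) i) *
    (\sum_j normsq (eigvec (centered_sum A s) i *m A j (s j)) +
     n%:R^-1 * \sum_j \sum_k normsq (eigvec (centered_sum A s) i *m A j k)).
Proof.
move=> n0 hA hLf hf; have n0' : (0 : K) < (2 * n)%:R by rewrite ltr0n muln_gt0.
set X := centered_sum A; have hX s : X s \is hermsymmx by exact: herm_centered_sum.
pose D s j k := X s - X (tperm j k * s)%g.
have tpK j k : involutive (fun s : 'S_n => (tperm j k * s)%g).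
  by move=> s; rewrite mulgA tperm2 mul1g.
rewrite -(ler_pM2l n0').
have step j k :
  \sum_s \sum_i f (eigval (X s) i) * qform (D s j k) (eigvec (X s) i) <=
  L * \sum_s \sum_i f (eigval (X s) i) * normsq (eigvec (X s) i *m D s j k).
  (* Both sides are doubled and one copy is reindexed by the involution [s -> (j k) s], so that each
     [X s] meets its exchanged partner. *)
  rewrite -(ler_pM2l (ltr0Sn K 1)) mulr_natl mulr2n.
  rewrite [X in _ + X <= _](reindex_inj (inv_inj (tpK j k))) -big_split /=.
  rewrite mulrCA [X in _ <= L * X]mulr_natl mulr2n.
  rewrite [X in _ <= _ * (_ + X)](reindex_inj (inv_inj (tpK j k))) -big_split /=.
  rewrite mulr_sumr; apply: ler_sum => s _; rewrite /D tpK.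
  exact: pair_trace_le.
(* The increments [D s j k] sum over [(j, k)] to [2 n X s], whose quadratic form at its own
   eigenvector is the eigenvalue. *)
have -> : (2 * n)%:R * (\sum_s \sum_i f (eigval (X s) i) * eigval (X s) i) =
   \sum_j \sum_k \sum_s \sum_i f (eigval (X s) i) * qform (D s j k) (eigvec (X s) i).
  under [RHS]eq_bigr do rewrite exchange_big /=.
  rewrite [RHS]exchange_big mulr_sumr /=; apply: eq_bigr => s _.
  under [RHS]eq_bigr do rewrite exchange_big /=.
  rewrite [RHS]exchange_big mulr_sumr /=; apply: eq_bigr => i _.
  under [RHS]eq_bigr do rewrite -mulr_sumr.
  rewrite -mulr_sumr mulrCA; congr (_ * _).
  rewrite -qform_eigvec // -qformZ -sum_centered_sum_tperm // qform_sum.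
  by apply: eq_bigr => j _; rewrite qform_sum.
apply: (@le_trans _ _ (\sum_j \sum_k L * \sum_s \sum_i
    f (eigval (X s) i) * normsq (eigvec (X s) i *m D s j k))).
  by apply: ler_sum => j _; apply: ler_sum => k _.
have -> : \sum_j \sum_k L * (\sum_s \sum_i
    f (eigval (X s) i) * normsq (eigvec (X s) i *m D s j k)) =
  \sum_s \sum_i L * f (eigval (X s) i) *
    \sum_j \sum_k normsq (eigvec (X s) i *m D s j k).
  under eq_bigr do rewrite -mulr_sumr exchange_big /=.
  rewrite -mulr_sumr exchange_big mulr_sumr /=; apply: eq_bigr => s _.
  under eq_bigr do rewrite exchange_big /=.
  rewrite exchange_big mulr_sumr /=; apply: eq_bigr => i _.
  by under eq_bigr do rewrite -mulr_sumr; rewrite -mulr_sumr mulrA.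
rewrite mulrCA -!mulrA mulr_sumr mulr_sumr mulr_sumr; apply: ler_sum => s _.
rewrite !mulr_sumr; apply: ler_sum => i _; set u := eigvec _ _.
rewrite (_ : 4 * (L * _) = L * f (eigval (X s) i) * (4 * ((2 * n)%:R *
   (\sum_j normsq (u *m A j (s j)) +
    n%:R^-1 * \sum_j \sum_k normsq (u *m A j k))))); last first.
  by move: (_%:R) (f _) (_ + _) => x y z; ring.
apply: ler_wpM2l => //.
(* The four-term inequality bounds each increment, and [sum_pairs] then yields the factor [2 n]. *)
clear step; apply: (@le_trans _ _ (\sum_j \sum_k 4 * (normsq (u *m A j (s j)) +
   normsq (u *m A k (s k)) + normsq (u *m A j (s k)) + normsq (u *m A k (s j))))).
  apply: ler_sum => j _; apply: ler_sum => k _.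
  by rewrite /D centered_sum_tperm !mulmxBr mulmxDr normsq_alt4.
under eq_bigr do rewrite -mulr_sumr.
rewrite -mulr_sumr ler_pM2l //.
by rewrite (@sum_pairs _ n (fun j k => normsq (u *m A j k))).
Qed.

(** * Scalar inequalities and moment generating functions *)

Lemma is_derive_nincr (K : realType) (f f' : K -> K) (a b : K) : a <= b ->
  (forall x, a <= x <= b -> is_derive x 1 f (f' x)) ->
  (forall x, a <= x <= b -> f' x <= 0) -> f b <= f a.
Proof.
move=> ab df f'0; have [c||c] := @MVT_segment K f f' a b ab.
- by rewrite in_itv /= => /andP[ac cb]; apply: df; rewrite !ltW.
- apply: derivable_within_continuous => x; rewrite in_itv /= => /df dfx.
  exact: ex_derive.
- rewrite in_itv /= => /f'0 fc e; rewrite -subr_le0 e.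
  by rewrite mulr_le0_ge0 // subr_ge0.
Qed.

(** This is [tanh (y / 2) <= y / 2] with denominators cleared. The difference vanishes at [0] and
    has derivative [e^x (1 - x - e^(-x)) <= 0]. *)
Lemma expR_tanh_le (K : realType) (y : K) : 0 <= y ->
  2 * (expR y - 1) <= y * (expR y + 1).
Proof.
move=> y0; rewrite -subr_le0.
have -> : 0 = 2 * (expR 0 - 1) - 0 * (expR 0 + 1) :> K by rewrite expR0; ring.
apply: (@is_derive_nincr K (fun x => 2 * (expR x - 1) - x * (expR x + 1))
  (fun x => expR x - 1 - x * expR x)) => // x /andP[x0 _].
  apply: is_derive_eq; rewrite /GRing.scale /=; ring.
have := expR_ge1Dx (- x); rewrite expRN => h.
rewrite -subr_ge0 (_ : 0 - _ = expR x * ((expR x)^-1 - (1 - x))).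
  by rewrite mulr_ge0 ?expR_ge0 // subr_ge0.
by field; rewrite gt_eqF // expR_gt0.
Qed.

(** By symmetry [b <= a]; factoring out [e^(t b)] leaves [expR_tanh_le] at [y = t (a - b)]. *)
Lemma expR_mean_value_le (K : realType) (t a b : K) : 0 <= t ->
  (a - b) * (expR (t * a) - expR (t * b)) <=
  t / 2 * ((a - b) ^+ 2 * (expR (t * a) + expR (t * b))).
Proof.
move=> t0; wlog ba : a b / b <= a.
  move=> h; have [/h //|/ltW/h] := leP b a.
  by rewrite -[a - b]opprB sqrrN mulNr -mulrN opprB (addrC (expR (t * a))).
have y0 : 0 <= t * (a - b) by rewrite mulr_ge0 // subr_ge0.
have -> : t * a = t * (a - b) + t * b by ring.
have ab0 : 0 <= a - b by rewrite subr_ge0.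
have h := expR_tanh_le y0; rewrite expRD -subr_ge0.
set e := expR (t * (a - b)) in h *; set g := expR (t * b).
rewrite (_ : _ - _ = (a - b) / 2 * g * (t * (a - b) * (e + 1) - 2 * (e - 1))).
  by rewrite mulr_ge0 ?subr_ge0 // !mulr_ge0 ?expR_ge0 // invr_ge0.
by field.
Qed.

(** Left unnormalised: over pairs of a permutation and an eigenvalue index it is [n!] times
    [E tr e^(t X)]. *)
Definition mgf {K : realType} {I : finType} (x : I -> K) (t : K) : K :=
  \sum_i expR (t * x i).

Definition dmgf {K : realType} {I : finType} (x : I -> K) (t : K) : K :=
  \sum_i expR (t * x i) * x i.

Lemma is_derive_mgf (K : realType) (I : finType) (x : I -> K) (t : K) :
  is_derive t 1 (mgf x) (dmgf x t).
Proof.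
rewrite (_ : mgf x = \sum_i (fun t => expR (t * x i))); last first.
  by apply/funext => r; rewrite fct_sumE.
rewrite /dmgf; elim/big_ind2 : _ => [|f f' g g' hf hg|i _].
- exact: is_derive_cst.
- exact: is_deriveD.
- by apply: is_derive_eq; rewrite /GRing.scale /=; ring.
Qed.

Lemma mgf0 (K : realType) (I : finType) (x : I -> K) : mgf x 0 = #|I|%:R.
Proof.
by rewrite /mgf; under eq_bigr do rewrite mul0r expR0; rewrite sumr_const.
Qed.

Lemma mgf_ge0 (K : realType) (I : finType) (x : I -> K) t : 0 <= mgf x t.
Proof. by apply: sumr_ge0 => i _; exact: expR_ge0. Qed.

(** Gronwall's argument: with [k = 1 - c t] frozen, [mgf x r * e^(- v r^2 / (2 k))] is nonincreasing
    on [[0, t]]. *)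
Lemma mgf_le (K : realType) (I : finType) (x : I -> K) (v c : K) :
  0 <= v -> 0 <= c ->
  (forall t, 0 <= t -> c * t < 1 -> (1 - c * t) * dmgf x t <= v * t * mgf x t) ->
  forall t, 0 <= t -> c * t < 1 ->
  mgf x t <= #|I|%:R * expR (v * t ^+ 2 / (2 * (1 - c * t))).
Proof.
(* On [0, t] the factor [1 - c r] may be replaced by the constant [1 - c t]. *)
move=> v0 c0 h t t0 ct1; set k := 1 - c * t.
have k0 : 0 < k by rewrite subr_gt0.
rewrite -ler_pdivrMr ?expR_gt0 // -expRN.
have -> : (#|I|%:R : K) = mgf x 0 * expR (- (v * 0 ^+ 2 / (2 * k))).
  by rewrite mgf0 expr0n mulr0 mul0r oppr0 expR0 mulr1.
apply: (@is_derive_nincr K (fun r => mgf x r * expR (- (v * r ^+ 2 / (2 * k))))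
  (fun r => expR (- (v * r ^+ 2 / (2 * k))) *
    (dmgf x r - v * r / k * mgf x r)) 0 t t0).
- move=> r _; have dm := is_derive_mgf x r.
  have de : is_derive r 1 (fun r => expR (- (v * r ^+ 2 / (2 * k))))
     (expR (- (v * r ^+ 2 / (2 * k))) * (- (v * r / k))).
    apply: is_derive_eq; rewrite /GRing.scale /=; field; exact: lt0r_neq0.
  by apply: is_derive_eq; rewrite /GRing.scale /=; ring.
- move=> r /andP[r0 rt]; rewrite mulr_ge0_le0 ?expR_ge0 // subr_le0.
  rewrite mulrAC ler_pdivlMr // mulrC.
  (* Shrinking the factor to [k] is legitimate only for a nonnegative derivative; a negative one
     makes the claim trivial. *)
  have [d0|d0] := leP 0 (dmgf x r); last first.
    apply: (@le_trans _ _ 0); first by rewrite mulr_ge0_le0 // ltW.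
    by rewrite !mulr_ge0 ?mgf_ge0.
  have crt : c * r <= c * t by exact: ler_wpM2l.
  apply: le_trans (h r r0 (le_lt_trans crt ct1)).
  by rewrite ler_wpM2r // lerD2l lerN2.
Qed.

(* The convexity inequality [e^y >= 1 + y], i.e. the scalar form of the
   variational formula for the entropy, summed against the weights [p]. *)
Lemma entropy_young (K : realType) (I J : finType) (p : I -> J -> K)
    (x : I -> K) (y : J -> K) (t k : K) :
  (forall i j, 0 <= p i j) -> (forall i, \sum_j p i j = 1) ->
  (forall j, \sum_i p i j = 1) ->
  \sum_i expR (t * x i) * \sum_j p i j * y j <=
  t * dmgf x t - (k + 1) * mgf x t + expR k * \sum_j expR (y j).
Proof.
move=> p0 pr pc.
have -> : t * dmgf x t - (k + 1) * mgf x t =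
    \sum_i \sum_j p i j * (expR (t * x i) * (t * x i - k - 1)).
  under eq_bigr do rewrite -mulr_suml pr mul1r.
  rewrite /dmgf /mgf !mulr_sumr -sumrB; apply: eq_bigr => i _; ring.
have -> : expR k * (\sum_j expR (y j)) = \sum_i \sum_j p i j * expR (k + y j).
  rewrite exchange_big mulr_sumr /=; apply: eq_bigr => j _.
  by rewrite -mulr_suml pc mul1r expRD.
rewrite -big_split; apply: ler_sum => i _.
rewrite -big_split mulr_sumr; apply: ler_sum => j _ /=.
rewrite -mulrDr mulrCA ler_wpM2l // -lerBlDl.
have -> : expR (k + y j) = expR (t * x i) * expR (k + y j - t * x i).
  by rewrite -expRD; congr expR; ring.
rewrite -mulrBr ler_wpM2l ?expR_ge0 //.
by apply: le_trans (expR_ge1Dx _); apply: le_of_eq; ring.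
Qed.

Lemma le_two_sqrt (K : realType) (x a b : K) : 0 <= a -> 0 <= b ->
  (forall u, 0 < u -> x <= a * u + b / u) -> x <= 2 * Num.sqrt (a * b).
Proof.
move=> a0 b0 h; rewrite leNgt; apply/negP => xab.
have x0 : 0 < x by apply: le_lt_trans xab; rewrite mulr_ge0 ?sqrtr_ge0.
have xab2 : 4 * (a * b) < x ^+ 2.
  have := xab; rewrite -(ltr_sqr (mulr_ge0 _ (sqrtr_ge0 _)) (ltW x0)) //.
  by rewrite exprMn sqr_sqrtr ?mulr_ge0 // (_ : 2 ^+ 2 = 4 :> K) // -natrX.
move: a0; rewrite le_eqVlt => /orP[/eqP a0|a0].
  (* For [a = 0] this [u] gives [x <= b x / (b + 1)], which is absurd. *)
  have := h ((b + 1) / x); rewrite -a0 mul0r add0r invf_div divr_gt0 ?ltr_wpDl //.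
  move=> /(_ isT); rewrite mulrA ler_pdivlMr ?ltr_wpDl // mulrC ler_pM2r //.
  by rewrite gerDl ler10.
(* This [u] turns the hypothesis into [x^2 <= 4 a b]; unlike the minimiser [sqrt (b / a)] it stays
   positive when [b = 0]. *)
have := h (x / (2 * a)); rewrite divr_gt0 ?mulr_gt0 // => /(_ isT).
apply/negP; rewrite -ltNge -subr_gt0.
rewrite (_ : _ - _ = (x ^+ 2 - 4 * (a * b)) / (2 * x)).
  by rewrite divr_gt0 ?subr_gt0 ?mulr_gt0.
by field; rewrite !gt_eqF.
Qed.

(** At [th = t / (v + c t)] one has [1 - c th = v / (v + c t)], and the exponent is exactly
    [- t^2 / (2 (v + c t))]. *)
Lemma laplace_tail_le (K : realType) (v c t y : K) : 0 <= v -> 0 < c -> 0 < t ->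
  (forall th, 0 <= th -> c * th < 1 ->
    y <= expR (v * th ^+ 2 / (2 * (1 - c * th)) - th * t)) ->
  y <= expR (- t ^+ 2 / (2 * v + 2 * c * t)).
Proof.
move=> v0 c0 t0 h; have ct : 0 < c * t by rewrite mulr_gt0.
move: v0; rewrite le_eqVlt => /orP[/eqP v0|v0].
  (* For [v = 0] the general choice would be the excluded endpoint [1 / c]; its half already gives
     the exponent [- t / (2 c)]. *)
  apply: le_trans (h (2 * c)^-1 _ _) _.
  - by rewrite invr_ge0 mulr_ge0 // ltW.
  - by rewrite invfM mulrCA divff ?gt_eqF // mulr1 invf_lt1 // ltr1n.
  - rewrite ler_expR -v0 !mul0r mulr0 !add0r; apply: le_of_eq.
    by field; rewrite !gt_eqF.
have vct : 0 < v + c * t by rewrite addr_gt0.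
have e : 1 - c * (t / (v + c * t)) = v / (v + c * t) by field; rewrite gt_eqF.
apply: le_trans (h (t / (v + c * t)) _ _) _.
- by rewrite ltW // divr_gt0.
- by rewrite -subr_gt0 e divr_gt0.
- rewrite ler_expR e; apply: le_of_eq; field.
  rewrite !gt_eqF //=.
  by rewrite (_ : 2 * v + 2 * c * t = 2 * (v + c * t)) ?mulr_gt0 //; ring.
Qed.

(** * Trace moment generating functions of the array and of its squares *)

Definition sum_eigval {K : realType} {n d : nat} (A : 'I_n -> 'I_n -> 'M[K[i]]_d)
  (p : 'S_n * 'I_d) : K := eigval (centered_sum A p.1) p.2.

Definition sqarray {K : realType} {n d : nat} (A : 'I_n -> 'I_n -> 'M[K[i]]_d) j k :=
  A j k *m A j k.

Lemma herm_sqarray (K : realType) n d (A : 'I_n -> 'I_n -> 'M[K[i]]_d) j k :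
  (forall j k, A j k \is hermsymmx) -> sqarray A j k \is hermsymmx.
Proof. by move=> hA; exact: herm_sqr. Qed.

Lemma dmgf_eigval_le (K : realType) n d (A : 'I_n -> 'I_n -> 'M[K[i]]_d) (t : K) :
  (0 < n)%N -> (forall j k, A j k \is hermsymmx) -> 0 <= t ->
  dmgf (sum_eigval A) t <= 2 * t * \sum_s \sum_i expR (t * sum_eigval A (s, i)) *
    (\sum_j normsq (eigvec (centered_sum A s) i *m A j (s j)) +
     n%:R^-1 * \sum_j \sum_k normsq (eigvec (centered_sum A s) i *m A j k)).
Proof.
move=> n0 hA t0; rewrite (_ : 2 * t = 4 * (t / 2)); last by field.
rewrite /dmgf -(pair_bigA _ (fun s i =>
  expR (t * sum_eigval A (s, i)) * sum_eigval A (s, i))) /=.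
apply: (exchange_trace_le (f := fun a => expR (t * a))) => // [a|a b].
  by rewrite mulr_ge0 ?expR_ge0 // divr_ge0.
exact: expR_mean_value_le.
Qed.

(** Jensen's inequality via [e^y >= 1 + y]: the exchange inequality with [f = -1] and [L = 0] makes
    the sum of all eigenvalues nonnegative. *)
Lemma mgf_eigval_ge (K : realType) n d (A : 'I_n -> 'I_n -> 'M[K[i]]_d) (t : K) :
  (0 < n)%N -> (forall j k, A j k \is hermsymmx) -> 0 <= t ->
  #|{: 'S_n * 'I_d}|%:R <= mgf (sum_eigval A) t.
Proof.
move=> n0 hA t0; have spec_ge0 : 0 <= \sum_p sum_eigval A p.
  have /= := @exchange_trace_le K n d A (fun _ => -1) 0 n0 hA.
  rewrite mulr0 mul0r => h; rewrite -oppr_le0.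
  apply: le_trans (h _ _); last 2 first.
  - by move=> _; rewrite mul0r.
  - by move=> a b; rewrite subrr mulr0 mul0r.
  rewrite -(pair_bigA _ (fun s i => sum_eigval A (s, i))) /= -sumrN.
  apply: ler_sum => s _; rewrite -sumrN; apply: ler_sum => i _.
  by rewrite mulN1r.
apply: (@le_trans _ _ (\sum_p (1 + t * sum_eigval A p))); last first.
  by apply: ler_sum => p _; exact: expR_ge1Dx.
by rewrite big_split /= sumr_const -mulr_sumr lerDl mulr_ge0.
Qed.

Lemma qform_mean (K : realType) n d (A : 'I_n -> 'I_n -> 'M[K[i]]_d) u :
  qform (mean A) u = n%:R^-1 * \sum_j \sum_k qform (A j k) u.
Proof. by rewrite qformZ qform_sum; under eq_bigr do rewrite qform_sum. Qed.

Definition matvar {K : realType} {n d : nat} (A : 'I_n -> 'I_n -> 'M[K[i]]_d) : K :=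
  n%:R^-1 * spectral_norm (\sum_j \sum_k sqarray A j k).

Lemma matvar_ge0 (K : realType) n d (A : 'I_n -> 'I_n -> 'M[K[i]]_d) : 0 <= matvar A.
Proof. by rewrite mulr_ge0 ?invr_ge0 ?spectral_norm_ge0. Qed.

(** [Y + S = (Y - S) + 2 S], and on a unit vector the form of [S] is at most its spectral norm,
    [matvar A]. *)
Lemma variance_proxy_le (K : realType) n d (A : 'I_n -> 'I_n -> 'M[K[i]]_d)
    (s : 'S_n) u :
  (0 < d)%N -> (forall j k, A j k \is hermsymmx) -> normsq u = 1 ->
  \sum_j normsq (u *m A j (s j)) + n%:R^-1 * \sum_j \sum_k normsq (u *m A j k) <=
  qform (centered_sum (sqarray A) s) u + 2 * matvar A.
Proof.
move=> d0 hA u1.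
have -> : \sum_j \sum_k normsq (u *m A j k) = \sum_j \sum_k qform (sqarray A j k) u.
  by apply: eq_bigr => j _; apply: eq_bigr => k _; rewrite -qform_sqr.
have -> : \sum_j normsq (u *m A j (s j)) = qform (perm_sum (sqarray A) s) u.
  by rewrite qform_sum; apply: eq_bigr => j _; rewrite -qform_sqr.
rewrite qformD qformN -addrA lerD2l -qform_mean -lerBlDl opprK.
rewrite -mulr2n -[_ *+ 2]mulr_natl ler_pM2l // qformZ ler_wpM2l ?invr_ge0 //.
rewrite -[leRHS]mulr1 -u1; apply: qform_le_spectral_norm => //.
by apply: herm_sum => j; apply: herm_sum => k; exact: herm_sqarray.
Qed.

(** The derivative bound for the array of squares involves fourth powers, and [A^4 <= R^2 A^2]; so
    its variance proxy is at most [R^2 (W + 2 sigma^2)], and [W] is the very sum being studied. *)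
Lemma dmgf_eigval_sqarray_le (K : realType) n d (A : 'I_n -> 'I_n -> 'M[K[i]]_d)
    (R t : K) :
  (0 < n)%N -> (0 < d)%N -> (forall j k, A j k \is hermsymmx) ->
  (forall j k, spectral_norm (A j k) <= R) -> 0 <= t ->
  dmgf (sum_eigval (sqarray A)) t <=
  2 * R ^+ 2 * t * (dmgf (sum_eigval (sqarray A)) t +
                    2 * matvar A * mgf (sum_eigval (sqarray A)) t).
Proof.
move=> n0 d0 hA hR t0; set sigma2 := matvar A.
have hA2 j k : sqarray A j k \is hermsymmx by exact: herm_sqarray.
apply: le_trans (dmgf_eigval_le n0 hA2 t0) _.
have -> : 2 * R ^+ 2 * t * (dmgf (sum_eigval (sqarray A)) t +
                            2 * sigma2 * mgf (sum_eigval (sqarray A)) t) =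
    2 * t * \sum_s \sum_i expR (t * sum_eigval (sqarray A) (s, i)) *
      (R ^+ 2 * (sum_eigval (sqarray A) (s, i) + 2 * sigma2)).
  rewrite (pair_bigA _ (fun s i => expR (t * sum_eigval (sqarray A) (s, i)) *
    (R ^+ 2 * (sum_eigval (sqarray A) (s, i) + 2 * sigma2)))) /dmgf /mgf /=.
  rewrite [2 * R ^+ 2]mulrC -!(mulrA (R ^+ 2)) mulrCA; congr (_ * _).
  rewrite mulrDr !mulr_sumr -big_split; apply: eq_bigr => -[s i] _ /=.
  by ring.
rewrite ler_wpM2l ?mulr_ge0 //; apply: ler_sum => s _; apply: ler_sum => i _.
rewrite ler_wpM2l ?expR_ge0 // /sum_eigval /=; set u := eigvec _ _.
have step j k : normsq (u *m sqarray A j k) <= R ^+ 2 * normsq (u *m A j k).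
  rewrite mulmxA; apply: le_trans (normsq_mul_le _ d0 (hA j k)) _.
  rewrite ler_wpM2r ?normsq_ge0 // ler_sqr ?nnegrE ?spectral_norm_ge0 //.
  exact: le_trans (spectral_norm_ge0 _) (hR j k).
rewrite -(qform_eigvec i (herm_centered_sum s hA2)).
apply: le_trans (ler_wpM2l (sqr_ge0 R) (variance_proxy_le s d0 hA (normsq_eigvec _ _))).
rewrite mulrDr mulrCA !mulr_sumr lerD //; first by apply: ler_sum.
rewrite ler_sum // => j _; rewrite ler_wpM2l ?invr_ge0 //.
by rewrite mulr_sumr ler_sum.
Qed.

(** [mgf_le] with [v = 4 R^2 sigma^2] and [c = 2 R^2], at the point where [c t = 1 / 2]. *)
Lemma mgf_eigval_sqarray_le (K : realType) n d (A : 'I_n -> 'I_n -> 'M[K[i]]_d)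
    (R : K) :
  (0 < n)%N -> (0 < d)%N -> (forall j k, A j k \is hermsymmx) ->
  (forall j k, spectral_norm (A j k) <= R) -> 0 < R ->
  mgf (sum_eigval (sqarray A)) (4 * R ^+ 2)^-1 <=
  #|{: 'S_n * 'I_d}|%:R * expR (matvar A / (4 * R ^+ 2)).
Proof.
move=> n0 d0 hA hR R0; set sigma2 := matvar A.
have R1 : R != 0 by rewrite gt_eqF.
have s0 : 0 <= sigma2 := matvar_ge0 A.
have RR : 0 < 4 * R ^+ 2 by rewrite mulr_gt0 // exprn_gt0.
have v0 : 0 <= 4 * R ^+ 2 * sigma2 by rewrite mulr_ge0 // ltW.
have c0 : 0 <= 2 * R ^+ 2 by rewrite mulr_ge0 // sqr_ge0.
have e : 2 * R ^+ 2 * (4 * R ^+ 2)^-1 = 2^-1 by field.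
rewrite (_ : sigma2 / _ = 4 * R ^+ 2 * sigma2 * (4 * R ^+ 2)^-1 ^+ 2 /
   (2 * (1 - 2 * R ^+ 2 * (4 * R ^+ 2)^-1))); last by rewrite e; field.
apply: mgf_le => //; last 2 first.
- by rewrite invr_ge0 ltW.
- by rewrite e invf_lt1 // ltr1n.
move=> t t0 _; have := dmgf_eigval_sqarray_le n0 d0 hA hR t0; rewrite -/sigma2.
by move: (dmgf _ _) (mgf _ _) => x y; lra.
Qed.

Lemma dmgf_eigval_bound (K : realType) n d (A : 'I_n -> 'I_n -> 'M[K[i]]_d)
    (R t : K) :
  (0 < n)%N -> (0 < d)%N -> (forall j k, A j k \is hermsymmx) ->
  (forall j k, spectral_norm (A j k) <= R) -> 0 < R -> 0 <= t ->
  dmgf (sum_eigval A) t <=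
  8 * R ^+ 2 * t ^+ 2 * dmgf (sum_eigval A) t +
  6 * matvar A * t * mgf (sum_eigval A) t.
Proof.
move=> n0 d0 hA hR R0 t0; set sigma2 := matvar A.
have R1 : R != 0 by rewrite gt_eqF.
have hA2 j k : sqarray A j k \is hermsymmx by exact: herm_sqarray.
set Y := \sum_s \sum_i expR (t * sum_eigval A (s, i)) *
  qform (centered_sum (sqarray A) s) (eigvec (centered_sum A s) i).
have dY : dmgf (sum_eigval A) t <= 2 * t * (Y + 2 * sigma2 * mgf (sum_eigval A) t).
  apply: le_trans (dmgf_eigval_le n0 hA t0) _; rewrite ler_wpM2l ?mulr_ge0 //.
  rewrite /mgf -(pair_bigA _ (fun s i => expR (t * sum_eigval A (s, i)))) /=.
  rewrite mulr_sumr -big_split; apply: ler_sum => s _.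
  rewrite mulr_sumr -big_split; apply: ler_sum => i _ /=.
  rewrite [2 * sigma2 * _]mulrC -mulrDr ler_wpM2l ?expR_ge0 //.
  by apply: variance_proxy_le => //; exact: normsq_eigvec.
(* The parameter at which the moment generating function of [W] is used. *)
pose r := (4 * R ^+ 2)^-1.
have r0 : 0 < r by rewrite invr_gt0 mulr_gt0 // exprn_gt0.
have rY : r * Y <= t * dmgf (sum_eigval A) t + sigma2 * r * mgf (sum_eigval A) t.
  (* Chosen so that [e^k] cancels the factor [e^(sigma^2 r)] in the bound on the moment generating
     function of [W] at [r]. *)
  pose k := - (sigma2 * r).
  pose p s := overlap (centered_sum A s) (centered_sum (sqarray A) s).
  have colsum s j : \sum_i p s i j = 1.
    by under eq_bigr do rewrite /p overlap_sym; exact: sum_overlap.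
  (* Young's inequality is used for each [s] separately, since the weights compare the eigenbases of
     [X s] and [W s]. *)
  have step s : r * \sum_i expR (t * sum_eigval A (s, i)) *
      qform (centered_sum (sqarray A) s) (eigvec (centered_sum A s) i) <=
      t * dmgf (fun i => sum_eigval A (s, i)) t -
      (k + 1) * mgf (fun i => sum_eigval A (s, i)) t +
      expR k * mgf (fun j => sum_eigval (sqarray A) (s, j)) r.
    apply: le_trans (entropy_young (p := p s) (fun i => sum_eigval A (s, i))
      (fun j => r * sum_eigval (sqarray A) (s, j)) t k
      (overlap_ge0 _ _) (sum_overlap _ _) (colsum s)).
    apply: le_of_eq; rewrite mulr_sumr; apply: eq_bigr => i _.
    rewrite mulrCA; congr (_ * _).
    rewrite qform_overlap ?herm_centered_sum // mulr_sumr.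
    by apply: eq_bigr => j _; rewrite mulrCA.
  have dmgfE :
      dmgf (sum_eigval A) t = \sum_s dmgf (fun i => sum_eigval A (s, i)) t.
    by rewrite /dmgf -(pair_bigA _ (fun s i =>
      expR (t * sum_eigval A (s, i)) * sum_eigval A (s, i))).
  have mgfE (B : 'I_n -> 'I_n -> 'M[K[i]]_d) (c : K) :
      mgf (sum_eigval B) c = \sum_s mgf (fun i => sum_eigval B (s, i)) c.
    by rewrite /mgf -(pair_bigA _ (fun s i => expR (c * sum_eigval B (s, i)))).
  have : r * Y <= t * dmgf (sum_eigval A) t - (k + 1) * mgf (sum_eigval A) t +
      expR k * mgf (sum_eigval (sqarray A)) r.
    rewrite dmgfE (mgfE A) (mgfE (sqarray A)) /Y !mulr_sumr -sumrB -big_split /=.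
    by apply: ler_sum => s _; exact: step.
  (* Both sides are compared with the number of pairs [(s, i)]; this term then absorbs the [- m] in
     [- (k + 1) m]. *)
  have : expR k * mgf (sum_eigval (sqarray A)) r <= mgf (sum_eigval A) t.
    apply: le_trans (mgf_eigval_ge n0 hA t0).
    rewrite /k expRN ler_pdivrMl ?expR_gt0 // mulrC.
    exact: mgf_eigval_sqarray_le.
  move=> h1 h2; apply: le_trans h2 _; rewrite /k mulrDl mul1r opprD addrA mulNr opprK.
  by apply: le_trans (lerD (lexx _) h1) _; rewrite subrK.
apply: le_trans dY _.
have {}rY :
    Y <= 4 * R ^+ 2 * (t * dmgf (sum_eigval A) t) + sigma2 * mgf (sum_eigval A) t.
  rewrite -(ler_pM2l r0); apply: le_trans rY _; apply: le_of_eq.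
  by rewrite /r; move: sigma2 (mgf _ _) (dmgf _ _) => {}sigma2 x y; field.
have t2 : 0 <= 2 * t by rewrite mulr_ge0.
have : Y + 2 * sigma2 * mgf (sum_eigval A) t <=
  4 * R ^+ 2 * (t * dmgf (sum_eigval A) t) + 3 * sigma2 * mgf (sum_eigval A) t.
  by move: rY; move: (mgf _ _) (dmgf _ _) => x y; lra.
move=> /(ler_wpM2l t2) h; apply: le_trans h _; apply: le_of_eq; ring.
Qed.

Lemma mgf_eigval_le (K : realType) n d (A : 'I_n -> 'I_n -> 'M[K[i]]_d)
    (R t : K) :
  (0 < n)%N -> (0 < d)%N -> (forall j k, A j k \is hermsymmx) ->
  (forall j k, spectral_norm (A j k) <= R) -> 0 < R ->
  0 <= t -> 2 * Num.sqrt 2 * R * t < 1 ->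
  mgf (sum_eigval A) t <= (n`! * d)%:R *
    expR (6 * matvar A * t ^+ 2 / (2 * (1 - 2 * Num.sqrt 2 * R * t))).
Proof.
move=> n0 d0 hA hR R0 t0 ct1.
have -> : (n`! * d)%N = #|{: 'S_n * 'I_d}|.
  by rewrite card_prod card_ord card_Sn.
apply: mgf_le => //.
- by rewrite mulr_ge0 ?matvar_ge0.
- by rewrite !mulr_ge0 ?sqrtr_ge0 // ltW.
move=> r r0; set c := _ * R => cr1.
have c2 : c ^+ 2 = 8 * R ^+ 2.
  by rewrite /c !exprMn sqr_sqrtr //; ring.
have cr0 : 0 <= c * r by rewrite /c !mulr_ge0 ?sqrtr_ge0 // ltW.
have [d1|d1] := leP 0 (dmgf (sum_eigval A) r); last first.
  apply: (@le_trans _ _ 0); first by rewrite mulr_ge0_le0 ?subr_ge0 ?ltW.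
  by rewrite mulr_ge0 ?mgf_ge0 // mulr_ge0 // mulr_ge0 // matvar_ge0.
(* As [8 R^2 = c^2], the differential inequality carries [1 - (c r)^2], which is at least [1 - c r]
   because [0 <= c r < 1]. *)
apply: (@le_trans _ _ ((1 - (c * r) ^+ 2) * dmgf (sum_eigval A) r)).
  rewrite ler_wpM2r // lerD2l lerN2 expr2 ler_piMl // ltW //.
have := dmgf_eigval_bound n0 d0 hA hR R0 r0; rewrite exprMn c2.
by move: (mgf _ _) (dmgf _ _) => x y; lra.
Qed.

(** * Events and expectations under a uniform permutation *)

Lemma uniform_expectation (disp : measure_display) (T : measurableType disp)
    (K : realType) (P : probability T K) (n : nat) (pi : T -> 'S_n) (g : 'S_n -> K) :
  uniform_perm P pi ->
  ('E_P[fun w => g (pi w)] = (n`!%:R^-1 * \sum_s g s)%:E)%E.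
Proof.
move=> hpi; rewrite expectation.unlock.
(* [g (pi w)] is a finite combination of indicators of the events [pi = s], whose measurability
   [uniform_perm] provides. *)
transitivity (\int[P]_w (\sum_s (g s)%:E * (\1_(pi @^-1` [set s]) w)%:E))%E.
  apply: eq_integral => w _; under eq_bigr do rewrite -EFinM.
  rewrite sumEFin (bigD1 (pi w)) //= big1 => [|s sw].
    by rewrite indicE mem_set // mulr1 addr0.
  by rewrite indicE memNset ?mulr0 //= => e; rewrite e eqxx in sw.
have int1 s : P.-integrable setT (fun w => (\1_(pi @^-1` [set s]) w)%:E).
  exact/integrable_indic/(hpi s).1.
rewrite integral_sum => [|//|s]; last exact: integrableZl.
rewrite mulr_sumr -sumEFin; apply: eq_bigr => s _.
rewrite integralZl // integral_indic ?setIT //; last exact: (hpi s).1.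
transitivity ((g s)%:E * (n`!%:R^-1)%:E)%E; last by rewrite -EFinM mulrC.
by congr (_ * _)%E; exact: (hpi s).2.
Qed.

Lemma uniform_measurable (disp : measure_display) (T : measurableType disp)
    (K : realType) (P : probability T K) (n : nat) (pi : T -> 'S_n) (b : pred 'S_n) :
  uniform_perm P pi -> measurable [set w | b (pi w)].
Proof.
move=> hpi; rewrite (_ : [set w | _] = \bigcup_(s in [set s | b s]) pi @^-1` [set s]).
  by apply: fin_bigcup_measurable => [|s _]; [exact: finite_finset|exact: (hpi s).1].
by apply/seteqP; split => [w bw|w [s bs /= ->] //]; exists (pi w).
Qed.

Lemma uniform_probability (disp : measure_display) (T : measurableType disp)
    (K : realType) (P : probability T K) (n : nat) (pi : T -> 'S_n) (b : pred 'S_n) :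
  uniform_perm P pi ->
  (P [set w | b (pi w)] = (n`!%:R^-1 * \sum_s (b s)%:R)%:E)%E.
Proof.
move=> hpi; rewrite -(uniform_expectation (fun s => (b s)%:R) hpi).
rewrite (_ : (fun w => _) = \1_[set w | b (pi w)]); last first.
  apply/funext => w; rewrite indicE; case: (boolP (b (pi w))) => bw.
    by rewrite mem_set.
  by rewrite memNset //=; exact/negP.
by rewrite expectation_indic //; exact: uniform_measurable hpi.
Qed.

(** * Laplace transform bounds for the largest eigenvalue *)

Lemma expR_lambda_max_le (K : realType) n d (A : 'I_n -> 'I_n -> 'M[K[i]]_d) (t : K) :
  (0 < d)%N -> (forall j k, A j k \is hermsymmx) ->
  \sum_s expR (t * lambda_max (centered_sum A s)) <= mgf (sum_eigval A) t.
Proof.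
move=> d0 hA.
rewrite /mgf -(pair_bigA _ (fun s i => expR (t * sum_eigval A (s, i)))) /=.
apply: ler_sum => s _.
have [i ->] := lambda_max_eigval d0 (herm_centered_sum s hA).
by rewrite (bigD1 i) //= lerDl sumr_ge0 // => j _; exact: expR_ge0.
Qed.

Lemma lambda_max0 (K : realType) d : (0 < d)%N -> lambda_max (0 : 'M[K[i]]_d) = 0.
Proof.
move=> d0; have h0 : (0 : 'M[K[i]]_d) \is hermsymmx.
  by apply: adj_hermsymmx; rewrite linear0 map_mx0.
have [i ->] := lambda_max_eigval d0 h0.
by rewrite -qform_eigvec // qform0.
Qed.

Lemma spectral_norm_le0 (K : realType) d (A : 'M[K[i]]_d) : (0 < d)%N ->
  A \is hermsymmx -> spectral_norm A <= 0 -> A = 0.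
Proof.
move=> d0 hA A0; have sA : spectral_norm A = 0.
  by apply/le_anti; rewrite A0 spectral_norm_ge0.
apply/row_matrixP => i; rewrite row0 rowE; apply: normsq0_eq; apply/le_anti.
rewrite normsq_ge0 andbT; apply: le_trans (normsq_mul_le _ d0 hA) _.
by rewrite sA expr0n mul0r.
Qed.

Lemma lambda_max_tail (K : realType) n d (A : 'I_n -> 'I_n -> 'M[K[i]]_d)
    (R t : K) :
  (0 < n)%N -> (0 < d)%N -> (forall j k, A j k \is hermsymmx) ->
  (forall j k, spectral_norm (A j k) <= R) -> 0 < R -> 0 < t ->
  n`!%:R^-1 * \sum_s (t <= lambda_max (centered_sum A s))%R%:R <=
  d%:R * expR (- t ^+ 2 / (12 * matvar A + 4 * Num.sqrt 2 * R * t)).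
Proof.
move=> n0 d0 hA hR R0 t0.
have dr : 0 < (d%:R : K) by rewrite ltr0n.
have nr : 0 < (n`!%:R : K) by rewrite ltr0n fact_gt0.
rewrite -ler_pdivrMl //.
have -> : 12 * matvar A + 4 * Num.sqrt 2 * R * t =
  2 * (6 * matvar A) + 2 * (2 * Num.sqrt 2 * R) * t by ring.
apply: laplace_tail_le => //.
- by rewrite mulr_ge0 // matvar_ge0.
- by rewrite !mulr_gt0 // sqrtr_gt0.
move=> th th0 cth; rewrite !ler_pdivrMl // expRB.
rewrite mulrA mulrA -natrM ler_pdivlMr ?expR_gt0 // mulr_suml.
apply: le_trans (mgf_eigval_le n0 d0 hA hR R0 th0 cth).
apply: le_trans (expR_lambda_max_le th d0 hA).
(* Markov's inequality, term by term: the indicator of [t <= lambda_max] times [e^(th t)] is at most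
   [e^(th lambda_max)]. *)
apply: ler_sum => s _; have [tl|_] := leP t _; last first.
  by rewrite mulr0n mul0r expR_ge0.
by rewrite mulr1n mul1r ler_expR ler_wpM2l.
Qed.

Lemma lambda_max_mean (K : realType) n d (A : 'I_n -> 'I_n -> 'M[K[i]]_d)
    (R : K) :
  (0 < n)%N -> (0 < d)%N -> (forall j k, A j k \is hermsymmx) ->
  (forall j k, spectral_norm (A j k) <= R) -> 0 < R ->
  n`!%:R^-1 * \sum_s lambda_max (centered_sum A s) <=
  Num.sqrt (matvar A) * Num.sqrt (12 * ln d%:R) + 2 * Num.sqrt 2 * R * ln d%:R.
Proof.
move=> n0 d0 hA hR R0.
have dr : 0 < (d%:R : K) by rewrite ltr0n.
have nr : 0 < (n`!%:R : K) by rewrite ltr0n fact_gt0.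
have ld : 0 <= ln d%:R :> K by rewrite ln_ge0 // ler1n.
set m := _^-1 * _; set c := _ * R.
have c0 : 0 < c by rewrite /c !mulr_gt0 // sqrtr_gt0.
rewrite -lerBlDr; set x := m - _.
have -> : Num.sqrt (matvar A) * Num.sqrt (12 * ln d%:R) =
    2 * Num.sqrt (ln d%:R * (3 * matvar A)).
  have e2 : 2 = Num.sqrt (2 ^+ 2) :> K by rewrite sqrtr_sqr gtr0_norm.
  rewrite [in RHS]e2 -!sqrtrM ?matvar_ge0 ?sqr_ge0 //.
  by congr Num.sqrt; ring.
apply: le_two_sqrt => // [|u u0]; first by rewrite mulr_ge0 // matvar_ge0.
have uc : 0 < u + c by rewrite addr_gt0.
(* This substitution maps [u > 0] onto the range [0 < c th < 1]; the bound becomes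
   [m <= (u + c) ln d + 3 sigma^2 / u], ready for [le_two_sqrt]. *)
pose th := (u + c)^-1; have th0 : 0 < th by rewrite invr_gt0.
have e1 : 1 - c * th = u * th by rewrite /th; field; rewrite gt_eqF.
have cth : c * th < 1 by rewrite -subr_gt0 e1 mulr_gt0.
have := mgf_eigval_le n0 d0 hA hR R0 (ltW th0) cth.
(* Jensen's inequality, from the tangent line of the exponential at the mean [m]. *)
have mE : n`!%:R * expR (th * m) <= \sum_s expR (th * lambda_max (centered_sum A s)).
  have -> : n`!%:R * expR (th * m) =
      \sum_s expR (th * m) * (1 + th * (lambda_max (centered_sum A s) - m)).
    rewrite -mulr_sumr big_split /= -mulr_sumr sumrB !sumr_const card_Sn.
    rewrite -[m *+ _]mulr_natl /m mulrA divff ?gt_eqF // mul1r subrr mulr0 addr0.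
    by rewrite mulrC.
  apply: ler_sum => s _.
  have -> : th * lambda_max (centered_sum A s) =
    th * m + th * (lambda_max (centered_sum A s) - m) by ring.
  by rewrite expRD ler_wpM2l ?expR_ge0 // expR_ge1Dx.
move=> /(le_trans (le_trans mE (expR_lambda_max_le th d0 hA))).
rewrite natrM -mulrA ler_pM2l // -(lnK dr) -expRD ler_expR -/c e1.
rewrite mulrC -ler_pdivlMr // /th invrK => h.
rewrite /x lerBlDr; apply: le_trans h _; apply: le_of_eq.
by rewrite expRK; field; rewrite !gt_eqF.
Qed.

(* The quotient in the exponential is the division of extended reals, for which
   0^-1 = +oo and 0 * +oo = 0: when 12 sigma^2 + 4 sqrt 2 R t = 0, i.e. when
   the bound degenerates, it is 0 for t > 0 and d for t = 0. *)
Theorem corollary10p3 (K : realType) (n d : nat) (hn : (0 < n)%N)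
    (hd : (0 < d)%N) (A : 'I_n -> 'I_n -> 'M[K[i]]_d) (R : K)
    (hA : forall j k, A j k \is hermsymmx)
    (hA0 : \sum_(j < n) \sum_(k < n) A j k = 0)
    (hAR : forall j k, spectral_norm (A j k) <= R)
    (disp : measure_display) (T : measurableType disp) (P : probability T K)
    (pi : T -> 'S_n) (hpi : uniform_perm P pi) :
  let X := fun w : T => perm_sum A (pi w) in
  let sigma2 : K :=
    n%:R^-1 * spectral_norm (\sum_(j < n) \sum_(k < n) A j k *m A j k) in
  let sigma : K := Num.sqrt sigma2 in
  (forall t : K, 0 <= t ->
    (P [set w | (t <= lambda_max (X w))%R] <=
     d%:R%:E * expeR ((- t ^+ 2)%:E /
                      (12 * sigma2 + 4 * Num.sqrt 2 * R * t)%:E))%E) /\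
  ('E_P[fun w => lambda_max (X w)] <=
   (sigma * Num.sqrt (12 * ln d%:R) + 2 * Num.sqrt 2 * R * ln d%:R)%:E)%E.
Proof.
move=> X sigma2 sigma.
have XE s : perm_sum A s = centered_sum A s.
  by rewrite /centered_sum /mean hA0 scaler0 subr0.
have R0 : 0 <= R := le_trans (spectral_norm_ge0 _) (hAR (Ordinal hn) (Ordinal hn)).
have X0 s : R = 0 -> lambda_max (perm_sum A s) = 0.
  move=> r0; rewrite /perm_sum big1 ?lambda_max0 // => j _.
  by apply: spectral_norm_le0; rewrite // -r0.
split=> [t|].
  rewrite le_eqVlt => /predU1P[<-|t0].
    (* At [t = 0] the numerator [0] annihilates even an infinite inverse, so the bound is
       [d >= 1]. *)
    rewrite expr0n oppr0 mul0e expeR0 mule1.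
    apply: (@le_trans _ _ 1%E); last by rewrite lee_fin ler1n.
    apply: probability_le1.
    exact: (uniform_measurable (fun s => 0 <= lambda_max (perm_sum A s)) hpi).
  rewrite (uniform_probability (fun s => t <= lambda_max (perm_sum A s)) hpi).
  move: R0; rewrite le_eqVlt => /predU1P[/esym r0|R0].
    (* For [R = 0] every matrix is zero and the event is empty, as [t > 0]. *)
    rewrite big1 ?mulr0 => [|s _]; last by rewrite X0 // leNgt t0.
    by rewrite mule_ge0 ?expeR_ge0 ?lee_fin.
  have D0 : 12 * sigma2 + 4 * Num.sqrt 2 * R * t != 0.
    have c0 : 0 < 4 * Num.sqrt 2 * R * t by rewrite !mulr_gt0 // sqrtr_gt0.
    by rewrite gt_eqF // ltr_wpDl // mulr_ge0 // matvar_ge0.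
  rewrite inver (negbTE D0).
  rewrite -[leRHS]/((d%:R * expR
    (- t ^+ 2 / (12 * sigma2 + 4 * Num.sqrt 2 * R * t)))%:E).
  rewrite lee_fin.
  under eq_bigr do rewrite XE.
  exact: lambda_max_tail.
rewrite (uniform_expectation (fun s => lambda_max (perm_sum A s)) hpi) lee_fin.
move: R0; rewrite le_eqVlt => /predU1P[/esym r0|R0].
  rewrite big1 ?mulr0 => [|s _]; last exact: X0.
  have ld : 0 <= ln d%:R :> K by rewrite ln_ge0 // ler1n.
  by rewrite r0 mulr0 mul0r addr0 mulr_ge0 ?sqrtr_ge0.
under eq_bigr do rewrite XE.
exact: lambda_max_mean.
Qed.
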